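(* Let $X$ be a (real) Banach space containing an isomorphic copy of $c_0$. Then there is an equivalent norm $|||\cdot|||$ on $X$ such that, writing $B=\{x\in X: |||x|||\le 1\}$ and measuring diameters with respect to $|||\cdot|||$: (i) every nonempty relatively weakly open subset of $B$ has diameter $2$; and (ii) $B$ contains convex combinations of slices with arbitrarily small diameter, i.e. for every $\eta>0$ there is a convex combination of slices of $B$ whose diameter is less than $\eta$.
   Context: All Banach spaces are real. For a bounded set $C\subset X$, a slice of $C$ is a set of the form $\{x\in C: x^*(x)>\sup x^*(C)-\alpha\}$ with $x^*\in X^*$ and $0<\alpha<\sup x^*(C)$. A convex combination of slices of $C$ is a set $\sum_{i=1}^n\lambda_i S_i=\{\sum_{i=1}^n\lambda_i x_i: x_i\in S_i\}$ where $n\in\mathbb{N}$, $S_1,\dots,S_n$ are slices of $C$, $\lambda_i>0$ and $\sum_{i=1}^n\lambda_i=1$. ''Relatively weakly open'' refers to the weak topology of $X$ restricted to the set. *)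

(* Defs.v *)
From HB Require Import structures.
From mathcomp Require Import all_boot all_order all_algebra.
From mathcomp Require Import all_classical all_reals all_analysis.

Set Implicit Arguments.
Unset Strict Implicit.
Unset Printing Implicit Defensive.

Import Order.TTheory GRing.Theory Num.Theory.
Import numFieldNormedType.Exports.

Local Open Scope classical_set_scope.
Local Open Scope ring_scope.

Section c0.
Context {R : realType}.

Definition is_c0 : {pred nat -> R^o} := [pred u | `[< u @ \oo --> (0 : R^o) >]].

Lemma is_c0P (u : nat -> R^o) : reflect (u @ \oo --> (0 : R^o)) (u \in is_c0).
Proof. by rewrite inE; exact: asboolP. Qed.

Lemma is_c0_submod : submod_closed is_c0.
Proof.
split=> [|a u v /is_c0P u0 /is_c0P v0]; apply/is_c0P.
  exact: (@cvg_cst R^o).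
have <- : a *: 0 + 0 = 0 :> R^o by rewrite scaler0 addr0.
by apply: cvgD => //; exact: cvgZr.
Qed.

HB.instance Definition _ :=
  GRing.isSubmodClosed.Build R (nat -> R^o) is_c0 is_c0_submod.

Record c0 := C0 { c0_seq :> nat -> R^o ; c0_seqP : c0_seq \in is_c0 }.
HB.instance Definition _ := [isSub for c0_seq].
HB.instance Definition _ := [Choice of c0 by <:].
HB.instance Definition _ := [SubChoice_isSubLmodule of c0 by <:].

Definition c0_norm (u : c0) : R := sup (range (fun n => `|u n|)).

Lemma c0_has_sup (u : c0) : has_sup (range (fun n => `|u n|)).
Proof.
split; first by exists `|u 0%N|, 0%N.
have /is_c0P u0 := c0_seqP u.
have /cvg_seq_bounded : cvgn (u : nat -> R^o) by apply/cvg_ex; exists 0.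
move=> [M [_ /(_ (M + 1))]]; rewrite ltrDl ltr01 => /(_ isT) uM.
by exists (M + 1) => _ [n _ <-]; exact: uM.
Qed.

Lemma c0_norm_ub (u : c0) n : `|u n| <= c0_norm u.
Proof. by apply: sup_ubound; [case: (c0_has_sup u)|exists n]. Qed.

Lemma c0_norm_le (u : c0) M : (forall n, `|u n| <= M) -> c0_norm u <= M.
Proof.
by move=> uM; apply: ge_sup => [|_ [n _ <-]//]; case: (c0_has_sup u).
Qed.

Lemma c0_normD (u v : c0) : c0_norm (u + v) <= c0_norm u + c0_norm v.
Proof.
apply: c0_norm_le => n.
by rewrite (le_trans (ler_normD _ _)) ?lerD ?c0_norm_ub.
Qed.

Lemma c0_normZ (l : R) (u : c0) : c0_norm (l *: u) = `|l| * c0_norm u.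
Proof.
have lZ k (w : c0) : c0_norm (k *: w) <= `|k| * c0_norm w.
  apply: c0_norm_le => n.
  by rewrite [leLHS]normrM ler_wpM2l ?c0_norm_ub.
apply/eqP; rewrite eq_le lZ /=.
have [->|l0] := eqVneq l 0.
  by rewrite normr0 mul0r (le_trans _ (c0_norm_ub _ 0)).
rewrite -ler_pdivlMl ?normr_gt0// -normfV.
by rewrite -[in leLHS](scalerK l0 u) lZ.
Qed.

Lemma c0_norm0_eq0 (u : c0) : c0_norm u = 0 -> u = 0.
Proof.
move=> u0; apply/val_inj/funext => n; apply/eqP.
by rewrite -normr_le0 -u0 c0_norm_ub.
Qed.

HB.instance Definition _ :=
  Lmodule_isNormed.Build R c0 c0_normD c0_normZ c0_norm0_eq0.

End c0.
Arguments c0 : clear implicits.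

Section banach.
Context {R : realType}.

Definition contains_isomorphic_copy (U V : normedModType R) : Prop :=
  exists T : {linear U -> V}, exists m M : R, [/\ 0 < m, 0 < M &
    forall u, m * `|u| <= `|T u| <= M * `|u|].

Context {X : normedModType R}.

Definition is_norm (N : X -> R) : Prop :=
  [/\ forall x y, N (x + y) <= N x + N y,
      forall (l : R) x, N (l *: x) = `|l| * N x &
      forall x, N x = 0 -> x = 0].

Definition equivalent_norm (N : X -> R) : Prop :=
  is_norm N /\ exists m M : R, [/\ 0 < m, 0 < M &
    forall x, m * `|x| <= N x <= M * `|x|].

Definition unit_ball (N : X -> R) : set X := [set x | N x <= 1].

(* -oo on the empty set *)
Definition diam (N : X -> R) (A : set X) : \bar R :=
  ereal_sup [set (N (z.1 - z.2))%:E | z in A `*` A].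

(* An equivalent norm on X has the same continuous functionals, hence the same
   weak topology and the same slices, so these do not mention the norm N. *)
Definition topological_dual := {f : {linear X -> R^o} | continuous f}.

Definition dual_eval (f : topological_dual) : X -> R := sval f.

Definition weak_topology : topologicalType :=
  sup_topology (fun f : topological_dual =>
    Topological.class (initial_topology (sval f : X -> R^o))).

Definition relatively_weakly_open (B W : set X) : Prop :=
  exists2 U : set X, @open weak_topology U & W = B `&` U.

(* [sup] is the intended supremum only for bounded C *)
Definition is_slice (C S : set X) : Prop :=
  exists (f : topological_dual) (a : R), 0 < a < sup (dual_eval f @` C) /\
    S = [set x | C x /\ dual_eval f x > sup (dual_eval f @` C) - a].

Definition is_convex_combination_of_slices (C D : set X) : Prop :=
  exists (n : nat) (lambda : 'I_n -> R) (S : 'I_n -> set X),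
    [/\ forall i, is_slice C (S i),
        forall i, 0 < lambda i,
        \sum_(i < n) lambda i = 1 &
        D = [set \sum_(i < n) lambda i *: x i |
              x in [set x : 'I_n -> X | forall i, S i (x i)]]].

End banach.

(* Main.v *)
Require Import Defs.
From HB Require Import structures.
From mathcomp Require Import all_boot all_order all_algebra.
From mathcomp Require Import all_classical all_reals all_analysis.
From mathcomp Require Import lra ring.

Import Order.TTheory GRing.Theory Num.Theory.
Import numFieldNormedType.Exports.

Local Open Scope classical_set_scope.
Local Open Scope ring_scope.

(** The copy of c0 in X contains a copy of c, the space of convergent
sequences: a vector u in the role of the constant sequence 1, vectors e_k in
the role of the unit vectors, and functionals on X, obtained from the
Hahn-Banach theorem, that extend the coordinates h_k and the limit form l of c.
They satisfy h_j(e_k) = [j = k], h_j(u) = 1, l(e_k) = 0 and l(u) = 1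
([c0_frame_of_copy]).

The construction starts from a convex set P of finite nonnegative combinations
of the e_k whose coordinates lie in [0, 1].  It is generated by vectors g + e_n
and g' + e_n (n in nat), where (g, g') is a pair of rational convex combinations
of 0 and earlier generators, chosen so that every such pair is used for
infinitely many n.  The new unit ball is essentially the convex hull of

- A = 2P - u, the set -A, and
- a symmetric convex neighbourhood C of 0 on which all |h_k| are at most 1
  and which lies within a small distance of the span of the e_k.

Since |h_k| <= 1 on this hull, 2 e_k has new norm at least 2.

Weakly open sets have diameter 2 ([diam_weakly_open]).  A relatively weakly open
set contains a point lam (2g - u) - mu (2g' - u) + nu c of the hull, with
lam + mu + nu = 1, g and g' in P, and c in C.  After a small perturbation,
(g, g') is a pair used at infinitely many k.  For such k one may add e_k to g,
or add e_k to g', and one may move the k-th coordinate of c to 1 or to -1.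
Adding e_k to g and moving c upward, respectively adding e_k to g' and moving c
downward, yields two points of the hull whose difference is
2 (lam + mu + nu) e_k = 2 e_k.  Both stay in the given set for large k because
e_k tends weakly to 0.  It is to make this simultaneous motion possible that
generators come in pairs.

Convex combinations of slices can be small ([small_convex_combination]).
Call j initial when its pair is (0, 0), so that e_j itself is a generator.
The form h_j - l is at most 2 on the ball, with value 2 at 2 e_j - u, but it is
at most 0 on -A and at most 5/4 on C.  Hence a point of the slice where
h_j - l > 2 - a is, up to O(a), of the form 2p - u with p in P and h_j(p) close
to 1 ([slice_approx]).  This last condition forces h_k(p) to be small unless
one of the two parents g, g' of the coordinate k has a large j-th coordinate,
or j = k ([initial_cone_le]).  The coordinates of a point of P at distinct
initial indices add up to at most 1 ([sum_initial_le1]), so k can be relevant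
to a bounded total weight of slices only.  Hence two
averages of points taken in the slices of n initial indices differ in every
coordinate by O(1/n + a), and the norm of a finite combination of the e_k is
controlled by its coordinates. *)

(** * The Hahn-Banach theorem *)

Definition infimum {R : realType} {I : Type} (F : I -> R) : R := inf (range F).

Lemma infimum_le {R : realType} {I : Type} (F : I -> R) (m : R) (i : I) :
  (forall j, m <= F j) -> infimum F <= F i.
Proof.
move=> mF; have lb : has_lbound (range F) by exists m => _ [j _ <-].
by apply: (ge_inf lb); exists i.
Qed.

Lemma le_infimum {R : realType} {I : Type} (F : I -> R) (m : R) (i : I) :
  (forall j, m <= F j) -> m <= infimum F.
Proof.
by move=> mF; apply: lb_le_inf; [exists (F i), i|move=> _ [j _ <-]].
Qed.

Lemma infimum_adherent {R : realType} {I : Type} (F : I -> R) (m e : R) (i : I) :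
  (forall j, m <= F j) -> 0 < e -> exists j, F j < infimum F + e.
Proof.
move=> mF e0; have hF : has_inf (range F).
  by split; [exists (F i), i|exists m => _ [j _ <-]].
by have [_ [j _ <-] Fj] := inf_adherent e0 hF; exists j.
Qed.

Definition sublinear {R : realType} {X : lmodType R} (p : X -> R) : Prop :=
  (forall x y, p (x + y) <= p x + p y) /\
  (forall (t : R) x, 0 <= t -> p (t *: x) = t * p x).

Lemma sublinear_ge_opp {R : realType} {X : lmodType R} {p : X -> R} :
  sublinear p -> forall x, - p (- x) <= p x.
Proof.
move=> [pD pZ] x; have := pD x (- x).
by rewrite subrr -[X in p X](scale0r (0 : X)) pZ// mul0r => h; lra.
Qed.

Lemma sublinearP {R : realType} {X : lmodType R} (p : X -> R) :
  (forall x y, p (x + y) <= p x + p y) ->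
  (forall (t : R) x, 0 < t -> p (t *: x) <= t * p x) -> p 0 = 0 ->
  sublinear p.
Proof.
move=> pD pZ p0; split=> // t x; rewrite le_eqVlt => /predU1P[<-|t0].
  by rewrite scale0r p0 mul0r.
apply/eqP; rewrite eq_le pZ//=.
have ti : 0 < t^-1 by rewrite invr_gt0.
rewrite -ler_pdivlMl// (le_trans _ (pZ _ (t *: x) ti))//.
by rewrite scalerA mulVf ?gt_eqF// scale1r.
Qed.

Section sublinear_infimum.
Context {R : realType} {X : lmodType R} {I : Type} (F : I -> X -> R).
Context (p : X -> R).
Context (pF : forall i x, - p (- x) <= F i x).

(** The infimum of a family of functionals is sublinear as soon as the family is
directed enough to absorb sums and dilations.  This single criterion serves
three times: for chains, for the one-direction improvement of a sublinear form,
and for the form that encodes a prescribed restriction. *)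
Lemma sublinear_infimum (i0 : I) :
  (forall i j x y, exists k, F k (x + y) <= F i x + F j y) ->
  (forall i (t : R) x, 0 < t -> exists k, F k (t *: x) <= t * F i x) ->
  (forall i, 0 <= F i 0) -> (exists i, F i 0 = 0) ->
  sublinear (fun x => infimum (F ^~ x)).
Proof.
move=> FD FZ F0 [i1 F1].
have lef i x : infimum (F ^~ x) <= F i x
    by exact: (infimum_le (F ^~ x) (- p (- x)) i (pF ^~ x)).
apply: sublinearP => [x y|t x t0|].
- apply/ler_addgt0Pr => e e0.
  have e2 : 0 < e / 2 by lra.
  have [i Fi] := @infimum_adherent _ _ (F ^~ x) _ _ i0 (pF ^~ x) e2.
  have [j Fj] := @infimum_adherent _ _ (F ^~ y) _ _ i0 (pF ^~ y) e2.
  have [k Fk] := FD i j x y.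
  have := lef k (x + y); move: Fi Fj Fk => /=; lra.
- rewrite -ler_pdivrMl//; apply: le_infimum => // i.
  have [k Fk] := FZ i t x t0.
  by rewrite ler_pdivrMl// (le_trans _ Fk).
- apply/eqP; rewrite eq_le -{1}F1 lef/=.
  exact: le_infimum.
Qed.

End sublinear_infimum.

(** If s is minimal, it cannot be improved in the direction y: the sublinear form
inf_t (s(x + t y) - t s(y)) lies below s, hence equals s, and its term for t = 1
gives the missing inequality s(x) + s(y) <= s(x + y). *)
Lemma minimal_sublinear_additive {R : realType} {X : lmodType R} (s : X -> R) :
  sublinear s ->
  (forall s', sublinear s' -> (forall x, s' x <= s x) -> s' = s) ->
  forall x y, s (x + y) = s x + s y.
Proof.
move=> sub_s smin x y; have [sD sZ] := sub_s.
have s0 : s 0 = 0 by rewrite -(scale0r (0 : X)) sZ// mul0r.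
pose F (t : {nonneg R}) x := s (x + t%:num *: y) - t%:num * s y.
have sF t z : - s (- z) <= F t z.
  rewrite /F; have := sD (z + t%:num *: y) (- z).
  by rewrite addrAC subrr add0r sZ//; lra.
have Fle z : infimum (F ^~ z) <= s z.
  apply: (le_trans (@infimum_le _ _ (F ^~ z) _ 0%:nng (sF ^~ z))).
  by rewrite /F/= scale0r addr0 mul0r subr0.
have sI : sublinear (fun z => infimum (F ^~ z)).
  apply: (sublinear_infimum _ _ sF 0%:nng).
  - move=> t1 t2 a b; exists (t1%:num + t2%:num)%:nng; rewrite /F/=.
    have := sD (a + t1%:num *: y) (b + t2%:num *: y).
    by rewrite addrACA -scalerDl; lra.
  - move=> t r a r0; have rt : 0 <= r * t%:num by rewrite mulr_ge0// ltW.
    exists (NngNum rt); rewrite /F/= -scalerA -scalerDr (sZ _ _ (ltW r0)).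
    by rewrite mulrBr mulrA.
  - by move=> t; rewrite /F add0r sZ// subrr.
  - by exists 0%:nng; rewrite /F/= scale0r addr0 s0 mul0r subrr.
have {smin}sE := smin _ sI Fle.
apply/eqP; rewrite eq_le sD/= -lerBrDr.
have <- : infimum (F ^~ x) = s x := congr1 (@^~ x) sE.
apply: (le_trans (@infimum_le _ _ (F ^~ x) _ 1%:nng (sF ^~ x))).
by rewrite /F/= scale1r mul1r.
Qed.

(** Zorn's lemma for the reverse pointwise order: every sublinear s <= p is bounded
below by -p(-x), so chains have sublinear infima, and a minimal element is
linear. *)
Lemma exists_linear_le_sublinear {R : realType} {X : lmodType R} (p : X -> R) :
  sublinear p -> exists f : {scalar X}, forall x, f x <= p x.
Proof.
move=> sp.
pose S := {s : X -> R | sublinear s /\ forall x, s x <= p x}.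
pose le (s t : S) := `[< forall x, sval t x <= sval s x >].
have [||||[s [ss sp']] smin] := @Zorn S le.
- by move=> s; apply/asboolP.
- move=> r s t /asboolP rs /asboolP st; apply/asboolP => x.
  exact: le_trans (st x) (rs x).
- move=> [s Ps] [t Pt] /asboolP/= st /asboolP/= ts.
  by apply: eq_exist; apply/funext => x; apply/eqP; rewrite eq_le st ts.
- move=> A totA; have [[s1 As1]|A0] := pselect (A !=set0); last first.
    exists (exist (fun s => sublinear s /\ forall x, s x <= p x) p
      (conj sp (fun x => lexx _))) => s As.
    by exfalso; apply: A0; exists s.
  pose F (i : {s : S | A s}) : X -> R := sval (sval i).
  have pF i x : - p (- x) <= F i x.
    case: i => -[s [ss sp']] As; rewrite /F/=.
    by apply: le_trans (sublinear_ge_opp ss x); rewrite lerN2.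
  have F0 i : F i 0 = 0.
    case: i => -[s [[sD sZ] sb]] As; rewrite /F/=.
    by rewrite -(scale0r (0 : X)) sZ// mul0r.
  have sI : sublinear (fun z => infimum (F ^~ z)).
    apply: (sublinear_infimum _ _ pF (exist _ s1 As1)).
    + move=> [s As] [t At] x y; rewrite /F/=.
      have [sD _] := (svalP s).1; have [tD _] := (svalP t).1.
      case: (totA s t As At) => /asboolP st.
      * exists (exist _ t At) => /=; apply: (le_trans (tD x y)).
        by rewrite lerD2r.
      * exists (exist _ s As) => /=; apply: (le_trans (sD x y)).
        by rewrite lerD2l.
    + move=> i t x t0; exists i; case: i => -[s [[sD sZ] sb]] As; rewrite /F/=.
      by rewrite (sZ _ _ (ltW t0)).
    + by move=> i; rewrite F0.
    + by exists (exist _ s1 As1).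
  have Ile i x : infimum (F ^~ x) <= F i x.
    exact: (@infimum_le _ _ (F ^~ x) _ _ (pF ^~ x)).
  have sIp x : infimum (F ^~ x) <= p x.
    by apply: (le_trans (Ile (exist _ s1 As1) x)); exact: (svalP s1).2.
  exists (exist (fun s => sublinear s /\ forall x, s x <= p x) _
    (conj sI sIp)) => s As; apply/asboolP => x /=.
  exact: (Ile (exist _ s As)).
have sadd : forall x y, s (x + y) = s x + s y.
  apply: minimal_sublinear_additive => // s' ss' s's.
  have s'p x : s' x <= p x by exact: le_trans (s's x) (sp' x).
  have := smin (exist (fun s => sublinear s /\ forall x, s x <= p x) s' (conj ss' s'p)).
  by move=> /(_ (introT (asboolP _) s's)) /(congr1 sval).
have [_ sZ] := ss.
have s0 : s 0 = 0 by rewrite -(scale0r (0 : X)) sZ// mul0r.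
have sN x : s (- x) = - s x.
  by apply/eqP; rewrite -addr_eq0 -sadd addNr s0.
have slin : linear_for *%R s.
  move=> a x y; rewrite sadd; congr (_ + _).
  have [a0|a0] := leP 0 a; first exact: sZ.
  by rewrite -[a *: x]opprK -scaleNr sN sZ ?oppr_ge0 ?(ltW a0)// mulNr opprK.
pose H := GRing.isLinear.Build R X R *%R s slin.
pose f : {scalar X} := HB.pack s H.
by exists f.
Qed.

(** The sublinear form x |-> inf_v (p(x - T v) + f(v)) is below p and below f on the
range of T; a linear form below it must agree with f there.  Stating this along
a linear map T avoids speaking of subspaces. *)
Lemma hahn_banach {R : realType} {V X : lmodType R} (p : X -> R)
    (T : {linear V -> X}) (f : {scalar V}) :
  sublinear p -> (forall v, f v <= p (T v)) ->
  exists g : {scalar X}, (forall x, g x <= p x) /\ forall v, g (T v) = f v.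
Proof.
move=> sp fp; have [pD pZ] := sp.
have p0 : p 0 = 0 by rewrite -(scale0r (0 : X)) pZ// mul0r.
pose F (v : V) (x : X) : R := p (x - T v) + f v.
have pF v x : - p (- x) <= F v x.
  have := pD (x - T v) (- x); rewrite addrAC subrr add0r => h.
  by have := fp (- v); rewrite !linearN /F; lra.
have sI : sublinear (fun x => infimum (F ^~ x)).
  apply: (sublinear_infimum _ _ pF 0).
  - move=> v w x y; exists (v + w); rewrite /F.
    have := pD (x - T v) (y - T w).
    by rewrite addrACA -opprD -linearD (linearD f); lra.
  - move=> v t x t0; exists (t *: v).
    by rewrite /F linearZ/= -scalerBr (pZ _ _ (ltW t0)) linearZ mulrDr.
  - by move=> v; rewrite /F add0r; have := fp (- v); rewrite !linearN; lra.
  - by exists 0; rewrite /F (linear0 T) (linear0 f) subr0 p0 addr0.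
have [g gI] := exists_linear_le_sublinear _ sI.
have gF v x : g x <= F v x.
  exact: le_trans (gI x) (@infimum_le _ _ (F ^~ x) _ v (pF ^~ x)).
have gf v : g (T v) <= f v.
  by apply: (le_trans (gF v _)); rewrite /F subrr p0 add0r.
exists g; split=> [x|v].
  by apply: (le_trans (gF 0 x)); rewrite /F (linear0 T) (linear0 f) subr0 addr0.
apply/eqP; rewrite eq_le gf/= -lerN2.
by have := gf (- v); rewrite !linearN.
Qed.

(** * A copy of c inside a space that contains c0 *)

Lemma c0_delta_subproof {R : realType} (j : nat) :
  (fun n => (n == j)%:R : R^o) \in @is_c0 R.
Proof.
apply/is_c0P/cvgrPdist_le => e e0; exists j.+1 => // n /= jn.
by rewrite gtn_eqF// subrr normr0 ltW.
Qed.

Definition c0_delta {R : realType} (j : nat) : c0 R := C0 (c0_delta_subproof j).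

Lemma c0_coordD {R : realType} (v w : c0 R) n : (v + w) n = v n + w n :> R.
Proof. by []. Qed.

Lemma c0_coordZ {R : realType} (a : R) (v : c0 R) n : (a *: v) n = a * v n :> R.
Proof. by []. Qed.

Lemma c0_coord_linear {R : realType} (a b : R) (i j : nat) :
  exists f : {scalar c0 R}, forall v, f v = a * v i + b * v j :> R.
Proof.
pose f0 (v : c0 R) : R := a * v i + b * v j.
have flin : linear_for *%R f0.
  by move=> t v w; rewrite /f0 !c0_coordD !c0_coordZ; ring.
pose H := GRing.isLinear.Build R (c0 R) R *%R f0 flin.
by exists (HB.pack_for {scalar c0 R} f0 H).
Qed.

(** A copy of the span of the unit vectors and of the constant sequence in c,
together with bounded extensions to X of the coordinate forms and of the
limit. *)
Record c0_frame {R : realType} {X : normedModType R} := C0Frame {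
  vec : nat -> X ;
  unit_vec : X ;
  coord : nat -> {scalar X} ;
  lim_form : {scalar X} ;
  coord_bound : R ;
  vec_bound : R ;
  coord_vec : forall j k, coord j (vec k) = (j == k)%:R ;
  coord_unit : forall j, coord j unit_vec = 1 ;
  lim_vec : forall k, lim_form (vec k) = 0 ;
  lim_unit : lim_form unit_vec = 1 ;
  coord_bound_gt0 : 0 < coord_bound ;
  vec_bound_gt0 : 0 < vec_bound ;
  coord_le : forall k x, `|coord k x| <= coord_bound * `|x| ;
  lim_le : forall x, `|lim_form x| <= coord_bound * `|x| ;
  vec_sum_le : forall n (c : nat -> R) b, (forall k, `|c k| <= b) ->
    `|\sum_(k < n) c k *: vec k| <= vec_bound * b }.
Arguments c0_frame {R} X.

(** c is isomorphic to c0: the unit vector of index 0 plays the constant sequence,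
the others are shifted by one, and the k-th coordinate of c becomes
v |-> v_(k+1) + v_0. *)
Lemma c0_frame_of_copy {R : realType} {X : normedModType R} :
  contains_isomorphic_copy (c0 R) X -> inhabited (c0_frame X).
Proof.
move=> [T [m [M [m0 M0 TmM]]]].
have ext a b i j : `|a| + `|b| <= 2 -> exists g : {scalar X},
    (forall x, `|g x| <= 2 / m * `|x|) /\
    forall v, g (T v) = a * v i + b * v j :> R.
  move=> ab; have [f fE] := c0_coord_linear a b i j.
  have c0_le (v : c0 R) k : `|v k| <= m^-1 * `|T v| :> R.
    have /andP[mT _] := TmM v.
    rewrite ler_pdivlMl//; apply: le_trans mT.
    by rewrite ler_pM2l//; exact: c0_norm_ub.
  have [||g [gp gT]] := hahn_banach (fun x => 2 / m * `|x|) T f.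
  - have m2 : 0 <= 2 / m by rewrite divr_ge0// ltW.
    split=> [x y|t x t0]; first by rewrite -mulrDr ler_wpM2l// ler_normD.
    by rewrite normrZ ger0_norm// mulrCA.
  - move=> v; rewrite fE (le_trans (ler_norm _))// (le_trans (ler_normD _ _))//.
    rewrite !normrM.
    apply: (@le_trans _ _ ((`|a| + `|b|) * (m^-1 * `|T v|))).
      by rewrite mulrDl lerD// ler_wpM2l// c0_le.
    by rewrite -mulrA ler_wpM2r// mulr_ge0// invr_ge0 ltW.
  - exists g; split=> [x|v]; last by rewrite gT fE.
    by rewrite ler_norml gp andbT lerNl -linearN -(normrN x) gp.
have [|l [lle lT]] := ext 1 0 0%N 0%N; first by rewrite normr1 normr0; lra.
have /choice[h hP] k : exists g : {scalar X},
    (forall x, `|g x| <= 2 / m * `|x|) /\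
    forall v, g (T v) = 1 * v k.+1 + 1 * v 0%N :> R.
  by apply: ext; rewrite normr1; lra.
have m2 : 0 < 2 / m by rewrite divr_gt0.
unshelve eapply (inhabits (@C0Frame R X (fun k => T (c0_delta k.+1)) (T (c0_delta 0)) h l
  (2 / m) M _ _ _ _ m2 M0 (fun k => (hP k).1) lle _)) => //.
- move=> j k; rewrite (hP j).2 /= eqSS; lra.
- by move=> j; rewrite (hP j).2 /=; lra.
- by move=> k; rewrite lT /=; lra.
- by rewrite lT /=; lra.
- move=> n c b cb; pose w : c0 R := \sum_(k < n) c k *: c0_delta k.+1.
  have -> : \sum_(k < n) c k *: T (c0_delta k.+1) = T w.
    by rewrite linear_sum; apply: eq_bigr => k _; rewrite linearZ.
  have /andP[_ /le_trans] := TmM w; apply; rewrite ler_pM2l//.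
  apply: c0_norm_le => i.
  have b0 : 0 <= b := le_trans (normr_ge0 _) (cb 0%N).
  have wE : w i = \sum_(k < n) c k * (i == k.+1)%:R :> R.
    rewrite /w; elim/big_ind2 : _ => // x1 x2 y1 y2 <- <-.
    exact: c0_coordD.
  case: i wE => [|i] wE.
    by rewrite [w _]wE big1 ?normr0// => k _; rewrite mulr0.
  have [ltin|lein] := ltnP i n.
    rewrite [w _]wE (bigD1 (Ordinal ltin))//= eqxx mulr1 big1 ?addr0// => k.
    by rewrite -val_eqE eq_sym eqSS => /negPf /= ->; rewrite mulr0.
  rewrite [w _]wE big1 ?normr0// => k _.
  by rewrite eqSS gtn_eqF ?mulr0// (leq_trans _ lein).
Qed.

(** * Norms from gauges *)

Section gauge.
Context {R : realType} {X : normedModType R} (G : R -> X -> Prop) (m M : R).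
Context (m_gt0 : 0 < m).
Context (M_gt0 : 0 < M).
Context (G_ge : forall s x, G s x -> m * `|x| <= s).
Context (G_ex : forall x, G (M * `|x|) x).
Context (G_D : forall s t x y, G s x -> G t y -> G (s + t) (x + y)).
Context (G_Z : forall a s x, G s x -> G (`|a| * s) (a *: x)).

(** G s x is to be read as: x belongs to s times a fixed symmetric convex set.
Working with the graded relation instead of the set turns convexity into
additivity and avoids divisions. *)
Definition gauge (x : X) : R := inf [set s | G s x].

Lemma gauge_le s x : G s x -> gauge x <= s.
Proof.
move=> Gs; have lb : has_lbound [set s | G s x].
  by exists (m * `|x|) => t; exact: G_ge.
exact: (ge_inf lb Gs).
Qed.

Lemma gauge_ge x c : (forall s, G s x -> c <= s) -> c <= gauge x.
Proof. by move=> cG; apply: lb_le_inf => //; exists (M * `|x|); exact: G_ex. Qed.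

Lemma gauge_lt x t : gauge x < t -> exists2 s, s < t & G s x.
Proof.
move=> xt; apply: contrapT => nG.
suff : t <= gauge x by rewrite leNgt xt.
apply: gauge_ge => s Gs; rewrite leNgt; apply/negP => st.
by apply: nG; exists s.
Qed.

Lemma gauge_le_eps x t : (forall e, 0 < e -> exists2 s, s <= t + e & G s x) ->
  gauge x <= t.
Proof.
move=> xt; apply/ler_addgt0Pr => e /xt[s st Gs].
exact: le_trans (gauge_le s x Gs) st.
Qed.

Lemma gauge_eps x t e : gauge x <= t -> 0 < e -> exists2 s, s <= t + e & G s x.
Proof.
move=> xt e0; have [|s st Gs] := gauge_lt x (t + e); first lra.
by exists s => //; exact: ltW.
Qed.

Lemma gaugeZ_le a x : gauge (a *: x) <= `|a| * gauge x.
Proof.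
apply: gauge_le_eps => e e0.
have a0 : 0 < `|a| + 1 by rewrite ltr_wpDl.
have [|s st Gs] := gauge_eps x (gauge x) (e / (`|a| + 1)) (lexx _).
  by rewrite divr_gt0.
exists (`|a| * s); last exact: G_Z.
apply: (@le_trans _ _ (`|a| * (gauge x + e / (`|a| + 1)))).
  by rewrite ler_wpM2l.
rewrite mulrDr lerD2l mulrCA ler_piMr ?ltW// ltr_pdivrMr//; lra.
Qed.

Lemma gauge_equivalent_norm : equivalent_norm gauge.
Proof.
have lb x : m * `|x| <= gauge x by apply: gauge_ge => s; exact: G_ge.
split; last first.
  by exists m, M; split=> // x; rewrite lb/= gauge_le.
split.
- move=> x y; apply: gauge_le_eps => e e0.
  have e2 : 0 < e / 2 by lra.
  have [s sx Gx] := gauge_eps x _ _ (lexx _) e2.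
  have [t ty Gy] := gauge_eps y _ _ (lexx _) e2.
  by exists (s + t); [lra|exact: G_D].
- move=> a x; apply/eqP; rewrite eq_le gaugeZ_le/=.
  have [->|a0] := eqVneq a 0.
    by rewrite normr0 mul0r; apply: le_trans (lb _); rewrite mulr_ge0// ltW.
  rewrite -ler_pdivlMl ?normr_gt0// -normfV.
  by rewrite -[in leLHS](scalerK a0 x) gaugeZ_le.
- move=> x x0; apply/eqP; rewrite -normr_le0.
  by have := lb x; rewrite x0 pmulr_rle0.
Qed.

End gauge.

(** * The generators *)

Section generators.
Context {R : realType} {X : normedModType R} (F : c0_frame X).
Local Notation e := (vec F).
Local Notation u := (unit_vec F).
Local Notation h := (coord F).
Local Notation l := (lim_form F).
Local Notation K := (coord_bound F).
Local Notation M := (vec_bound F).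

(** Finite combinations of coordinates as bundled linear forms, so that the
maximum principle [gen_base_le] applies to them. *)
Lemma coord_comb (s : seq nat) (a : nat -> R) :
  exists f : {scalar X}, forall x, f x = \sum_(i <- s) a i * h i x.
Proof.
pose f0 x := \sum_(i <- s) a i * h i x.
have flin : linear_for *%R f0.
  move=> t x y; rewrite /f0 mulr_sumr -big_split/=; apply: eq_bigr => i _.
  by rewrite linearP; ring.
pose H := GRing.isLinear.Build R X R *%R f0 flin.
by exists (HB.pack_for {scalar X} f0 H).
Qed.

(** Membership in the span of the basic vectors, in a form that lets two vectors be
expanded over the same range. *)
Definition finite_vec (x : X) : Prop :=
  exists n, forall m, (n <= m)%N -> x = \sum_(k < m) h k x *: e k.

Lemma finite_vec0 : finite_vec 0.
Proof. by exists 0%N => m _; rewrite big1// => k _; rewrite linear0 scale0r. Qed.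

Lemma finite_vecD x y : finite_vec x -> finite_vec y -> finite_vec (x + y).
Proof.
move=> [n xn] [m ym]; exists (maxn n m) => k; rewrite geq_max => /andP[nk mk].
rewrite {1}(xn k nk) {1}(ym k mk) -big_split/=; apply: eq_bigr => i _.
by rewrite linearD scalerDl.
Qed.

Lemma finite_vecZ a x : finite_vec x -> finite_vec (a *: x).
Proof.
move=> [n xn]; exists n => k nk; rewrite {1}(xn k nk) scaler_sumr.
by apply: eq_bigr => i _; rewrite scalerA [h i (_ *: _)]linearZ.
Qed.

Lemma finite_vec_basis k : finite_vec (e k).
Proof.
exists k.+1 => m km; rewrite (bigD1 (Ordinal km))//= coord_vec eqxx scale1r.
rewrite big1 ?addr0// => i; rewrite -val_eqE/= => /negPf ik.
by rewrite coord_vec ik scale0r.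
Qed.

Lemma finite_vec_sum (I : Type) (s : seq I) (a : I -> R) (v : I -> X) :
  (forall i, finite_vec (v i)) -> finite_vec (\sum_(i <- s) a i *: v i).
Proof.
move=> fv; elim/big_ind: _ => [||i _]; first exact: finite_vec0.
  exact: finite_vecD.
exact: finite_vecZ.
Qed.

Lemma finite_vec_norm_le x b :
  finite_vec x -> (forall k, `|h k x| <= b) -> `|x| <= M * b.
Proof.
move=> [n xn] xb; rewrite (xn n (leqnn n)).
exact: (vec_sum_le F n (fun k => h k x)).
Qed.

Lemma finite_vec_lim x : finite_vec x -> l x = 0.
Proof.
move=> [n xn]; rewrite (xn n (leqnn n)) linear_sum big1// => k _.
by rewrite linearZ/= lim_vec mulr0.
Qed.

(** Finite families of rational weights on generator labels.  Being countable,
they can be scheduled in advance, before the generators exist. *)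
Definition code : Type := seq ((nat * bool) * rat).

Definition subconvex (s : code) : bool :=
  all (fun x => 0 <= x.2) s && (\sum_(x <- s) x.2 <= 1).

(** The pair of codes used at time n.  The third component of the decoded triple is
there to make every pair reappear infinitely often. *)
Definition schedule (n : nat) (b : bool) : code :=
  if @unpickle (code * code * nat)%type n is Some t then
    let s := if b then t.1.1 else t.1.2 in if subconvex s then s else [::]
  else [::].

Lemma subconvex_schedule n b : subconvex (schedule n b).
Proof.
have sub0 : subconvex [::] by rewrite /subconvex/= big_nil.
by rewrite /schedule; case: unpickle => //= t; case: ifP.
Qed.

Lemma schedule_often (s t : code) N : subconvex s -> subconvex t ->
  exists n, [/\ (N <= n)%N, schedule n true = s & schedule n false = t].
Proof.
move=> ss st.
pose p (r : nat) : nat := pickle ((s, t, r) : code * code * nat).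
have p_inj : injective p by move=> i j /(pcan_inj (@pickleK _)) [].
suff [r Nr] : exists r, (N <= p r)%N.
  by exists (p r); rewrite /schedule pickleK /= ss st.
apply: contrapT => nN.
have lt r : (p r < N)%N.
  by rewrite ltnNge; apply/negP => Nr; apply: nN; exists r.
pose f (r : 'I_N.+1) := Ordinal (lt r).
have inj : injective f.
  by move=> i j /(congr1 val)/= /p_inj; exact: val_inj.
by have := leq_card f inj; rewrite !card_ord ltnn.
Qed.

Definition comb (v : nat * bool -> X) (s : code) : X :=
  \sum_(x <- s) ratr x.2 *: v x.1.

(** Table of the generators with label below n, and 0 elsewhere; since 0 is admitted
as a point, weights on labels that do not exist yet are harmless. *)
Fixpoint stage (n : nat) : nat * bool -> X :=
  if n is m.+1 then
    fun x => if x.1 == m then comb (stage m) (schedule m x.2) + e m else stage m x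
  else fun=> 0.

Definition gen (x : nat * bool) : X := stage x.1.+1 x.

(** The two parents of the coordinate n. *)
Definition base (n : nat) (b : bool) : X := comb (stage n) (schedule n b).

Lemma stageE n x : stage n x = if (x.1 < n)%N then gen x else 0.
Proof.
elim: n => //= n IHn; rewrite ltnS leq_eqVlt; case: eqVneq => [<-|xn] //=.
by rewrite /gen/= eqxx.
Qed.

Lemma genE n b : gen (n, b) = base n b + e n.
Proof. by rewrite /gen/= eqxx. Qed.

Lemma comb_le (f : {scalar X}) (v : nat * bool -> X) c s : 0 <= c ->
  subconvex s -> (forall x, f (v x) <= c) -> f (comb v s) <= c.
Proof.
move=> c0 /andP[/allP s0 s1] fv; rewrite linear_sum.
have sc : ratr (\sum_(x <- s) x.2) * c <= c :> R.
  by rewrite ler_piMl// -(rmorph1 (@ratr R)) ler_rat.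
apply: le_trans sc; rewrite rmorph_sum mulr_suml.
rewrite !big_seq; apply: ler_sum => x xs; rewrite linearZ/= ler_wpM2l//.
by rewrite ler0q s0.
Qed.

Lemma base_le (f : {scalar X}) c n b : 0 <= c ->
  (forall i b', (i < n)%N -> f (gen (i, b')) <= c) -> f (base n b) <= c.
Proof.
move=> c0 fg; apply: comb_le => // [|[i b']]; first exact: subconvex_schedule.
by rewrite stageE/=; case: ifP => [/fg|_] //; rewrite linear0.
Qed.

(** A maximum principle: a bound on a linear form survives convex combinations with
0, so it holds everywhere once it passes from a parent g of n to g + e_n. *)
Lemma gen_base_le (f : {scalar X}) c : 0 <= c ->
  (forall n b, f (base n b) <= c -> f (base n b + e n) <= c) ->
  (forall x, f (gen x) <= c) /\ (forall n b, f (base n b) <= c).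
Proof.
move=> c0 step.
have g x : f (gen x) <= c.
  case: x => n; elim/ltn_ind: n => n IHn b; rewrite genE; apply: step.
  by apply: base_le => // i b' /IHn.
by split=> // n b; apply: base_le => // i b' _.
Qed.

Lemma finite_vec_gen x : finite_vec (gen x).
Proof.
case: x => n; elim/ltn_ind: n => n IHn b; rewrite genE.
apply: finite_vecD (finite_vec_basis n); apply: finite_vec_sum => -[[i b'] q].
by rewrite stageE/=; case: ifP => [/IHn|_] //; exact: finite_vec0.
Qed.

Lemma coord_ge0 k : (forall x, 0 <= h k (gen x)) /\ forall n b, 0 <= h k (base n b).
Proof.
have [f fE] := coord_comb [:: k] (fun=> -1).
have {}fE x : f x = - h k x by rewrite fE big_seq1 mulN1r.
have [|g bs] := gen_base_le f 0 (lexx _).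
  move=> n b; rewrite !fE linearD coord_vec oppr_le0 => hb.
  by rewrite oppr_le0 addr_ge0.
by split=> [x|n b]; rewrite -oppr_le0 -fE.
Qed.

Lemma coord_gen_lt k n b : (n < k)%N -> h k (gen (n, b)) = 0.
Proof.
move=> nk; apply/eqP; rewrite eq_le (coord_ge0 k).1 andbT.
elim/ltn_ind: n b nk => n IHn b nk; rewrite genE linearD coord_vec gtn_eqF// addr0.
by apply: base_le => // i b' ni; apply: IHn => //; exact: ltn_trans nk.
Qed.

Lemma coord_base_le k n b : (n <= k)%N -> h k (base n b) = 0.
Proof.
move=> nk; apply/eqP; rewrite eq_le (coord_ge0 k).2 andbT.
by apply: base_le => // i b' ni; rewrite coord_gen_lt// (leq_trans ni).
Qed.

Lemma coord_le1 k : (forall x, h k (gen x) <= 1) /\ forall n b, h k (base n b) <= 1.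
Proof.
apply: gen_base_le => // n b hb; rewrite linearD coord_vec.
by case: eqVneq => [->|_]; [rewrite coord_base_le// add0r|rewrite addr0].
Qed.

Definition initial (j : nat) : Prop := forall b, base j b = 0.

Lemma initial_often N : exists2 n, (N <= n)%N & initial n.
Proof.
have s0 : subconvex [::] by rewrite /subconvex/= big_nil.
have [n [Nn s1 s2]] := schedule_often [::] [::] N s0 s0; exists n => // b.
by rewrite /base /comb; case: b; rewrite ?s1 ?s2 big_nil.
Qed.

(** An initial generator e_j carries weight 1 on the index j only, and other
generators inherit their weights on J from a convex combination. *)
Lemma sum_initial_le1 (J : seq nat) : uniq J -> (forall j, j \in J -> initial j) ->
  forall n b, \sum_(j <- J) h j (base n b) <= 1.
Proof.
move=> Ju Ji; have [f fE] := coord_comb J (fun=> 1).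
have [|_ bs] := gen_base_le f 1 ler01.
  move=> n b fb; have [nJ|nJ] := boolP (n \in J).
    rewrite Ji// add0r fE (bigD1_seq n)//= coord_vec eqxx mulr1 big1 ?addr0// => i.
    by move=> /negPf ni; rewrite coord_vec ni mulr0.
  rewrite linearD; suff -> : f (e n) = 0 by rewrite addr0.
  rewrite fE big_seq big1// => i iJ; rewrite coord_vec mul1r.
  by case: eqVneq iJ nJ => // -> ->.
by move=> n b; have := bs n b; rewrite fE; under eq_bigr do rewrite mul1r.
Qed.

(** The weight of a point on coordinate k is inherited through one of the two
parents of k, so it costs at least 1 - h_j(parent) of weight on j; the sum of
the two parents' coordinates gives a bound linear in the point. *)
Lemma initial_coord_le j k : initial j -> j != k -> forall x,
  h j (gen x) + h k (gen x) * (1 - h j (base k true) - h j (base k false)) <= 1.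
Proof.
move=> ij jk x.
set a := 1 - _ - _.
have [f fE] := coord_comb [:: j; k] (fun i => if i == j then 1 else a).
have {}fE y : f y = h j y + h k y * a.
  by rewrite fE big_cons big_seq1 eqxx eq_sym (negPf jk) mul1r mulrC.
rewrite -fE; apply: (gen_base_le f 1 ler01 _).1 => {x} n b fb.
(* n = j: the new point is e_j itself *)
have [nj|nj] := eqVneq n j.
  rewrite nj ij add0r fE !coord_vec eqxx eq_sym (negPf jk) mul0r addr0 //.
(* n is neither j nor k: the form does not see e_n *)
have [nk|nk] := eqVneq n k; last first.
  rewrite linearD [f (e n)]fE !coord_vec ![_ == n]eq_sym.
  by rewrite (negPf nj) (negPf nk) mul0r !addr0.
rewrite fE nk !linearD !coord_vec eqxx (negPf jk) 
  (coord_base_le _ _ b (leqnn k)) add0r mul1r addr0.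
rewrite /a; have := (coord_ge0 j).2 k (~~ b); case: b {fb} => /=; lra.
Qed.

End generators.

(** * The new unit ball *)

Section ball.
Context {R : realType} {X : normedModType R} (F : c0_frame X).
Local Notation e := (vec F).
Local Notation u := (unit_vec F).
Local Notation h := (coord F).
Local Notation l := (lim_form F).
Local Notation K := (coord_bound F).
Local Notation M := (vec_bound F).
Local Notation gen := (gen F).
Local Notation base := (base F).

(** lam times the convex hull of 0 and the generators. *)
Definition cone (lam : R) (p : X) : Prop :=
  exists s : seq ((nat * bool) * R), [/\ {in s, forall x, 0 <= x.2},
    \sum_(x <- s) x.2 <= lam & p = \sum_(x <- s) x.2 *: gen x.1].

Lemma cone0 lam : 0 <= lam -> cone lam 0.
Proof. by move=> lam0; exists [::]; rewrite !big_nil. Qed.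

Lemma cone_gen x lam : 0 <= lam -> cone lam (lam *: gen x).
Proof.
move=> lam0; exists [:: (x, lam)]; rewrite !big_seq1; split=> // y.
by rewrite inE => /eqP ->.
Qed.

Lemma cone_ge0 lam p : cone lam p -> 0 <= lam.
Proof.
by move=> [s [s0 + _]]; apply: le_trans; rewrite big_seq sumr_ge0.
Qed.

Lemma coneD lam mu p q : cone lam p -> cone mu q -> cone (lam + mu) (p + q).
Proof.
move=> [s [s0 sl ->]] [t [t0 tm ->]]; exists (s ++ t).
rewrite !big_cat/=; split=> // [x|]; last exact: lerD.
by rewrite mem_cat => /orP[/s0|/t0].
Qed.

Lemma coneZ a lam p : 0 <= a -> cone lam p -> cone (a * lam) (a *: p).
Proof.
move=> a0 [s [s0 sl ->]]; exists [seq (x.1, a * x.2) | x <- s].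
rewrite !big_map -mulr_sumr ler_wpM2l//; split=> //.
  by move=> _ /mapP[x xs ->]; rewrite mulr_ge0// s0.
by rewrite scaler_sumr; apply: eq_bigr => x _; rewrite scalerA.
Qed.

Lemma finite_vec_cone lam p : cone lam p -> finite_vec F p.
Proof.
by move=> [s [_ _ ->]]; apply: finite_vec_sum => x; exact: finite_vec_gen.
Qed.

Lemma cone_le (f : {scalar X}) c lam p : 0 <= c ->
  (forall x, f (gen x) <= c) -> cone lam p -> f p <= lam * c.
Proof.
move=> c0 fc [s [s0 sl ->]]; rewrite linear_sum.
apply: (@le_trans _ _ (\sum_(x <- s) x.2 * c)); last first.
  by rewrite -mulr_suml ler_wpM2r.
by rewrite !big_seq; apply: ler_sum => x xs; rewrite linearZ/= ler_wpM2l// s0.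
Qed.

Lemma coord_cone_ge0 k lam p : cone lam p -> 0 <= h k p.
Proof.
move=> [s [s0 _ ->]]; rewrite linear_sum big_seq sumr_ge0// => x xs.
by rewrite linearZ/= mulr_ge0 ?s0// (coord_ge0 F k).1.
Qed.

Lemma coord_cone_le k lam p : cone lam p -> h k p <= lam.
Proof.
by move=> /(cone_le _ 1 _ _ ler01 (coord_le1 F k).1); rewrite mulr1.
Qed.

Lemma norm_cone_le lam p : cone lam p -> `|p| <= M * lam.
Proof.
move=> cp; apply: finite_vec_norm_le; first exact: finite_vec_cone cp.
by move=> k; rewrite ger0_norm ?coord_cone_le ?(coord_cone_ge0 _ _ _ cp).
Qed.

Lemma initial_cone_le j k lam p : initial F j -> j != k -> cone lam p ->
  h j p + h k p * (1 - h j (base k true) - h j (base k false)) <= lam.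
Proof.
move=> ij jk cp; set a := 1 - _ - _.
have [f fE] := coord_comb F [:: j; k] (fun i => if i == j then 1 else a).
have {}fE y : f y = h j y + h k y * a.
  by rewrite fE big_cons big_seq1 eqxx eq_sym (negPf jk) mul1r mulrC.
rewrite -fE -[leRHS]mulr1; apply: cone_le => // x.
by rewrite fE; exact: initial_coord_le.
Qed.

Lemma rat_below (w d : R) : 0 <= w -> 0 < d ->
  exists q : rat, [/\ 0 <= q, ratr q <= w & w - ratr q <= d].
Proof.
rewrite le_eqVlt => /predU1P[<-|w0] d0.
  by exists 0; rewrite rmorph0 subr0; split=> //; exact: ltW.
have [|q] := @rat_in_itvoo R (Num.max 0 (w - d)) w.
  by rewrite gt_max w0/=; lra.
rewrite in_itv/= gt_max => /andP[/andP[q0 qd] qw]; exists q; split.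
- by rewrite -(ler0q R) ltW.
- exact: ltW.
- lra.
Qed.

(** Rounding the weights down to rationals keeps them subconvex, because missing
mass is put on 0. *)
Lemma comb_dense (s : seq ((nat * bool) * R)) eps : 0 < eps ->
  {in s, forall x, 0 <= x.2} -> \sum_(x <- s) x.2 <= 1 ->
  exists2 t : code, subconvex t &
    `|\sum_(x <- s) x.2 *: gen x.1 - comb gen t| <= eps.
Proof.
move=> eps0 s0 s1.
suff [t [t0 ts tx]] : exists t : code, [/\ all (fun x => 0 <= x.2) t,
    ratr (\sum_(x <- t) x.2) <= \sum_(x <- s) x.2 :> R &
    `|\sum_(x <- s) x.2 *: gen x.1 - comb gen t| <= eps].
  exists t => //; rewrite /subconvex t0/= -(ler_rat R) rmorph1.
  exact: le_trans s1.
elim: s eps eps0 s0 {s1} => [|[x w] s IHs] eps eps0 s0.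
  exists [::]; rewrite /comb !big_nil rmorph0 subrr normr0; split=> //.
  exact: ltW.
have [||t [t0 ts tx]] := IHs (eps / 2).
- lra.
- by move=> y ys; apply: s0; rewrite inE ys orbT.
have g0 : 0 < `|gen x| + 1 by rewrite ltr_wpDl.
have [||q [q0 qw wq]] := rat_below w (eps / 2 / (`|gen x| + 1)).
- by apply: (s0 (x, w)); rewrite inE eqxx.
- by rewrite divr_gt0//; lra.
exists ((x, q) :: t); rewrite /comb !big_cons/= q0 t0 rmorphD/= lerD//; split=> //.
rewrite opprD addrACA -scalerBl (le_trans (ler_normD _ _))//.
rewrite [leRHS](splitr eps) lerD// normrZ ger0_norm ?subr_ge0//.
apply: (le_trans (ler_wpM2r (normr_ge0 _) wq)).
by rewrite mulrAC ler_pdivrMr// ler_wpM2l//; lra.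
Qed.

Lemma cone_approx lam p eps : 0 < eps -> cone lam p ->
  exists2 t : code, subconvex t & `|p - lam *: comb gen t| <= eps.
Proof.
move=> eps0 cp; have lam0 := cone_ge0 _ _ cp; move: lam0.
rewrite le_eqVlt => /predU1P[lam0|lam0].
  exists [::]; first by rewrite /subconvex/= big_nil.
  rewrite -lam0 scale0r subr0 (le_trans (norm_cone_le _ _ cp))//.
  by rewrite -lam0 mulr0 ltW.
have li : 0 <= lam^-1 by rewrite invr_ge0 ltW.
have [s [s0 s1 sp]] := coneZ lam^-1 lam p li cp.
have [||t ts tp] := comb_dense s (eps / lam) _ s0; first by rewrite divr_gt0.
  by apply: (le_trans s1); rewrite mulVf// gt_eqF.
exists t => //; move: tp; rewrite -sp ler_pdivlMr// mulrC.
rewrite -{1}(gtr0_norm lam0) -normrZ scalerBr scalerA mulfV ?gt_eqF//.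
by rewrite scale1r.
Qed.

Lemma base_comb n b (t : code) : schedule n b = t ->
  (forall x, x \in t -> (x.1.1 < n)%N) -> base n b = comb gen t.
Proof.
move=> <- tn; rewrite /base /comb !big_seq; apply: eq_bigr => x xt.
by rewrite stageE tn.
Qed.

(** Up to a small perturbation, any two points of the cones are scaled parents of
the same coordinate k, for infinitely many k. *)
Lemma cone_attach lam mu p q eps : 0 < eps -> cone lam p -> cone mu q ->
  exists p' q', [/\ `|p - p'| <= eps, `|q - q'| <= eps &
    forall N, exists k, [/\ (N <= k)%N,
      cone lam p', cone mu q',
      cone lam (p' + lam *: e k) & cone mu (q' + mu *: e k)]].
Proof.
move=> eps0 cp cq; have lam0 := cone_ge0 _ _ cp; have mu0 := cone_ge0 _ _ cq.
have [s ss sp] := cone_approx _ _ _ eps0 cp.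
have [t st tq] := cone_approx _ _ _ eps0 cq.
exists (lam *: comb gen s), (mu *: comb gen t); split=> // N.
(* the index must exceed N and every label occurring in s and t *)
have [n [Nn ns nt]] := schedule_often s t
  (N + \sum_(x <- s) x.1.1.+1 + \sum_(x <- t) x.1.1.+1)%N ss st.
have lt_sum (r : code) x : x \in r -> (x.1.1 < \sum_(x <- r) x.1.1.+1)%N.
  by move=> xr; rewrite (big_rem x)//= addSn ltnS leq_addr.
have bs : base n true = comb gen s.
  apply: base_comb => // x xs; apply: leq_trans Nn.
  by rewrite -addnA addnCA; apply: leq_trans (lt_sum _ _ xs) (leq_addr _ _).
have bt : base n false = comb gen t.
  apply: base_comb => // x xs; apply: leq_trans Nn.
  by rewrite addnC; apply: leq_trans (lt_sum _ _ xs) (leq_addr _ _).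
have ccomb (r : code) nu : 0 <= nu -> subconvex r -> cone nu (nu *: comb gen r).
  move=> nu0 /andP[/allP r0 r1]; rewrite -[X in cone X]mulr1; apply: coneZ => //.
  exists [seq (x.1, ratr x.2) | x <- r]; rewrite !big_map; split=> //.
    by move=> _ /mapP[x xr ->]; rewrite ler0q r0.
  by move: r1; rewrite -(ler_rat R) rmorph_sum rmorph1.
exists n; split; try exact: ccomb.
- by rewrite -(leq_add2r (\sum_(x <- s) x.1.1.+1 + \sum_(x <- t) x.1.1.+1)) addnA
    (leq_trans Nn)// leq_addr.
- by rewrite -bs -scalerDr -genE; exact: cone_gen.
- by rewrite -bt -scalerDr -genE; exact: cone_gen.
Qed.

(** The slack is chosen so small that the limit form, which vanishes on the basic
vectors, is at most 1/4 on the core. *)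
Definition slack : R := (4 * K)^-1.

Lemma slack_gt0 : 0 < slack.
Proof. by rewrite invr_gt0 mulr_gt0 ?coord_bound_gt0. Qed.

Lemma bound_slack : K * slack = 4^-1.
Proof.
by rewrite /slack invfM mulrCA mulfV ?mulr1// gt_eqF// coord_bound_gt0.
Qed.

(** nu times the symmetric neighbourhood of 0 inside the ball.  Its points need not
be in the span of the basic vectors, only near it, but the bound on the
coordinates is exact: this is what yields diameter exactly 2. *)
Definition core (nu : R) (c : X) : Prop :=
  exists2 y, finite_vec F y &
    `|c - y| <= nu * slack /\ forall k, `|h k c| <= nu.

Lemma core_ge0 nu c : core nu c -> 0 <= nu.
Proof. by move=> [y _ [_ /(_ 0%N)]]; apply: le_trans. Qed.

Lemma core0 : core 0 0.
Proof.
exists 0; first exact: finite_vec0.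
by rewrite subrr normr0 mul0r; split=> // k; rewrite linear0 normr0.
Qed.

Lemma coreD nu mu c d : core nu c -> core mu d -> core (nu + mu) (c + d).
Proof.
move=> [y fy [cy hc]] [z fz [dz hd]]; exists (y + z); first exact: finite_vecD.
split=> [|k]; first by rewrite opprD addrACA mulrDl (le_trans (ler_normD _ _))// lerD.
by rewrite linearD (le_trans (ler_normD _ _))// lerD.
Qed.

Lemma coreZ a nu c : core nu c -> core (`|a| * nu) (a *: c).
Proof.
move=> [y fy [cy hc]]; exists (a *: y); first exact: finite_vecZ.
split=> [|k]; first by rewrite -scalerBr normrZ -mulrA ler_wpM2l.
by rewrite linearZ/= normrM ler_wpM2l.
Qed.

Lemma core_norm x : core (4 * K * `|x|) x.
Proof.
exists 0; first exact: finite_vec0.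
have K0 := coord_bound_gt0 F.
rewrite subr0 mulrAC mulfV ?mul1r; last by rewrite gt_eqF// mulr_gt0.
split=> // k; apply: (le_trans (coord_le F k x)).
by rewrite -mulrA ler_peMl ?mulr_ge0 ?(ltW K0)//; lra.
Qed.

Lemma core_lim_le nu c : core nu c -> `|l c| <= nu / 4.
Proof.
move=> [y fy [cy _]]; rewrite -(subr0 (l c)) -(finite_vec_lim _ _ fy) -linearB.
apply: (le_trans (lim_le F _)).
apply: (le_trans (ler_wpM2l (ltW (coord_bound_gt0 F)) cy)).
by rewrite mulrCA bound_slack.
Qed.

(** The coordinates of the nearby finite vector y are within nu / 4 of those of c,
hence at most 2 nu. *)
Lemma norm_core_le nu c : core nu c -> `|c| <= (slack + 2 * M) * nu.
Proof.
move=> cc; have nu0 := core_ge0 _ _ cc; move: cc => [y fy [cy hc]].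
rewrite -(subrK y c) (le_trans (ler_normD _ _))// mulrDl lerD 1?mulrC//.
apply: (@le_trans _ _ (M * (2 * nu))); last by rewrite mulrCA mulrC mulrA.
apply: finite_vec_norm_le => // k.
have -> : h k y = h k c - h k (c - y) by rewrite linearB; ring.
rewrite (le_trans (ler_normB _ _))//.
have := le_trans (coord_le F k (c - y))
  (ler_wpM2l (ltW (coord_bound_gt0 F)) cy).
by rewrite mulrCA bound_slack; have := hc k; lra.
Qed.

(** Any single coordinate can be moved to either extreme value without leaving the
core, since the distance to the span of the basic vectors does not change. *)
Lemma core_flip nu c k (s : bool) : core nu c ->
  core nu (c + ((-1) ^+ s * nu - h k c) *: e k).
Proof.
move=> cc; have nu0 := core_ge0 _ _ cc; move: cc => [y fy [cy hc]].
exists (y + ((-1) ^+ s * nu - h k c) *: e k).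
  by apply: finite_vecD fy _; apply: finite_vecZ; exact: finite_vec_basis.
split=> [|i]; first by rewrite opprD addrACA subrr addr0.
rewrite linearD linearZ/= coord_vec; have [->|_] := eqVneq i k.
  by rewrite mulr1 addrC subrK normrM normrX normrN1 expr1n mul1r ger0_norm.
by rewrite mulr0 addr0.
Qed.

(** s times the convex hull of 2P - u, u - 2P and the core, where P is the convex
hull of 0 and the generators; the vector is
(2p - lam u) - (2q - mu u) + c. *)
Definition hull (s : R) (x : X) : Prop :=
  exists lam mu nu p q c, [/\ cone lam p, cone mu q, core nu c,
    lam + mu + nu = s &
    x = 2 *: (p - q) - (lam - mu) *: u + c].

Lemma linear_hull (f : {scalar X}) t (p q c : X) :
  f (2 *: (p - q) - t *: u + c) = 2 * (f p - f q) - t * f u + f c.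
Proof. by rewrite (linearD f) !(linearB f) ![f (_ *: _)]linearZ/= (linearB f). Qed.

Lemma hullD s t x y : hull s x -> hull t y -> hull (s + t) (x + y).
Proof.
move=> [a [b [c [p [q [r [ap bq cr <- ->]]]]]]].
move=> [a' [b' [c' [p' [q' [r' [ap' bq' cr' <- ->]]]]]]].
exists (a + a'), (b + b'), (c + c'), (p + p'), (q + q'), (r + r').
split; [exact: coneD|exact: coneD|exact: coreD|by ring|].
have -> : a + a' - (b + b') = (a - b) + (a' - b') by ring.
rewrite [- (q + q')]opprD [p + p' + _]addrACA [2 *: (p - q + _)]scalerDr.
rewrite [(a - b + _) *: u]scalerDl opprD.
by rewrite [LHS]addrACA; congr (_ + _); rewrite [LHS]addrACA.
Qed.

Lemma hullN s x : hull s x -> hull s (- x).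
Proof.
move=> [a [b [c [p [q [r [ap bq cr <- ->]]]]]]].
exists b, a, c, q, p, (- r); split=> //.
- by have := coreZ (-1) _ _ cr; rewrite normrN1 mul1r scaleN1r.
- by ring.
- rewrite opprD opprB -[q - p]opprB -[b - a]opprB scalerN scaleNr opprK.
  by rewrite [- (2 *: _) + _]addrC.
Qed.

Lemma hullZ a s x : hull s x -> hull (`|a| * s) (a *: x).
Proof.
have pos b t y : 0 <= b -> hull t y -> hull (b * t) (b *: y).
  move=> b0 [lam [mu [nu [p [q [r [ap bq cr <- ->]]]]]]].
  exists (b * lam), (b * mu), (b * nu), (b *: p), (b *: q), (b *: r).
  split; [exact: coneZ|exact: coneZ| |by ring|].
    by have := coreZ b _ _ cr; rewrite ger0_norm.
  by rewrite !scalerDr !scalerN !scalerA -!mulrBr ![b * 2]mulrC.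
have [a0 hs|a0 hs] := ger0P a; first exact: pos.
rewrite -[a *: x]opprK -scaleNr; apply: hullN; apply: pos hs.
by rewrite oppr_ge0 ltW.
Qed.

Lemma core_hull nu c : core nu c -> hull nu c.
Proof.
move=> cc; exists 0, 0, nu, 0, 0, c; split=> //; try exact: cone0.
  by rewrite !add0r.
by rewrite !subr0 scale0r scaler0 subr0 add0r.
Qed.

Lemma coord_hull_le k s x : hull s x -> `|h k x| <= s.
Proof.
suff le_s y : hull s y -> h k y <= s.
  by move=> hx; rewrite ler_norml le_s// andbT lerNl -linearN le_s//; exact: hullN.
move=> [a [b [c [p [q [r [ap bq [_ _ [_ /(_ k) rc]] <- ->]]]]]]].
rewrite linear_hull coord_unit.
have := coord_cone_le k _ _ ap; have := coord_cone_ge0 k _ _ bq.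
by move: rc; rewrite ler_norml => /andP[_]; lra.
Qed.

Definition hull_bound : R := 4 * M + `|u| + slack.

Lemma hull_bound_gt0 : 0 < hull_bound.
Proof.
have := vec_bound_gt0 F; have := slack_gt0; have := normr_ge0 u.
by rewrite /hull_bound; lra.
Qed.

Lemma norm_hull_le s x : hull s x -> `|x| <= hull_bound * s.
Proof.
move=> [a [b [c [p [q [r [ap bq cr <- ->]]]]]]].
rewrite (le_trans (ler_normD _ _))//.
have a0 := cone_ge0 _ _ ap; have b0 := cone_ge0 _ _ bq; have c0 := core_ge0 _ _ cr.
apply: (@le_trans _ _ ((2 * M + `|u|) * (a + b) + (slack + 2 * M) * c)).
  rewrite lerD ?norm_core_le// (le_trans (ler_normB _ _))// mulrDl !normrZ.
  rewrite normr_nat -mulrA lerD ?ler_pM2l//.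
    by apply: (le_trans (ler_normB _ _)); rewrite mulrDr lerD ?norm_cone_le.
  by rewrite mulrC ler_wpM2l// ler_norml; apply/andP; split; lra.
have M0 := vec_bound_gt0 F; have s0 := slack_gt0; have u0 := normr_ge0 u.
have H1 : 2 * M + `|u| <= hull_bound by rewrite /hull_bound; lra.
have H2 : slack + 2 * M <= hull_bound by rewrite /hull_bound; lra.
by rewrite [leRHS]mulrDr lerD// ler_wpM2r// addr_ge0.
Qed.

Definition newnorm : X -> R := gauge hull.

Lemma hull_ge s x : hull s x -> hull_bound^-1 * `|x| <= s.
Proof.
by move=> /norm_hull_le; rewrite ler_pdivrMl// hull_bound_gt0.
Qed.

Lemma hull_ex x : hull (4 * K * `|x|) x.
Proof. by apply: core_hull; exact: core_norm. Qed.

Lemma newnorm_equivalent : equivalent_norm newnorm.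
Proof.
apply: (@gauge_equivalent_norm R X hull hull_bound^-1 (4 * K)).
- by rewrite invr_gt0 hull_bound_gt0.
- by rewrite mulr_gt0// coord_bound_gt0.
- exact: hull_ge.
- exact: hull_ex.
- exact: hullD.
- exact: hullZ.
Qed.

Lemma newnorm_le s x : hull s x -> newnorm x <= s.
Proof. by apply: gauge_le; exact: hull_ge. Qed.

Lemma newnorm_eps x t eps : newnorm x <= t -> 0 < eps ->
  exists2 s, s <= t + eps & hull s x.
Proof. apply: gauge_eps; exact: hull_ex. Qed.

End ball.

(** * Weakly open sets have diameter 2 *)

Lemma weak_open_eventually {R : realType} {X : normedModType R} (U : set X)
    (x : X) (y : nat -> X) : @open (@weak_topology R X) U -> U x ->
  (forall f : @topological_dual R X,
    (fun n => dual_eval f (y n) : R^o) @ \oo --> (dual_eval f x : R^o)) ->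
  \forall n \near \oo, U (y n).
Proof.
move=> oU Ux yx.
have yw : (y : nat -> @weak_topology R X) @ \oo --> (x : @weak_topology R X).
  apply/cvg_sup => f A; rewrite nbhsE => -[B [[V oV <-] Vx] BA].
  apply: filterS BA _; apply: yx; apply: open_nbhs_nbhs; split=> //.
by apply: yw; apply: open_nbhs_nbhs; split.
Qed.

Lemma dual_bounded {R : realType} {X : normedModType R} (f : @topological_dual R X) :
  exists2 C : R, 0 < C & forall x, `|dual_eval f x| <= C * `|x|.
Proof.
have fc : {for 0, continuous (sval f)} by exact: (svalP f).
have /linear_boundedP[C [Cr fC]] := continuous_linear_bounded 0 fc.
exists (Num.max 1 (C + 1)) => [|x]; first by rewrite lt_max ltr01.
by apply: fC; rewrite lt_max ltrDl ltr01 orbT.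
Qed.

Lemma dual_evalD {R : realType} {X : normedModType R} (f : @topological_dual R X)
  x y : dual_eval f (x + y) = dual_eval f x + dual_eval f y.
Proof. exact: linearD. Qed.

Lemma dual_evalZ {R : realType} {X : normedModType R} (f : @topological_dual R X)
  a x : dual_eval f (a *: x) = a * dual_eval f x.
Proof. exact: linearZ. Qed.

Section weak.
Context {R : realType} {X : normedModType R} (F : c0_frame X).
Local Notation e := (vec F).
Local Notation M := (vec_bound F).

(** The basic vectors behave as in c0: testing f against sums with signs as
coefficients bounds the series of the |f(e_k)|. *)
Lemma dual_basis_cvg0 (f : @topological_dual R X) :
  (fun k => dual_eval f (e k) : R^o) @ \oo --> (0 : R^o).
Proof.
have [C C0 fC] := dual_bounded f.
have eval_sum n (c : nat -> R) : dual_eval f (\sum_(k < n) c k *: e k) =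
    \sum_(k < n) c k * dual_eval f (e k).
  rewrite /dual_eval linear_sum; apply: eq_bigr => k _; exact: linearZ.
apply/norm_cvg0P; apply: (@cvg_series_cvg_0 R R^o); apply: nondecreasing_is_cvgn.
  by apply: nondecreasing_series => n _ _ /=; exact: normr_ge0.
exists (C * (M * 1)) => _ [n _ <-]; rewrite /series/= big_mkord.
have -> : \sum_(k < n) `|dual_eval f (e k)| =
    dual_eval f (\sum_(k < n) Num.sg (dual_eval f (e k)) *: e k).
  rewrite (eval_sum n (fun k => Num.sg (dual_eval f (e k)))).
  by apply: eq_bigr => k _; rewrite -normrEsg.
rewrite (le_trans (ler_norm _))// (le_trans (fC _))// ler_pM2l//.
apply: (vec_sum_le F n (fun k => Num.sg (dual_eval f (e k)))) => k.
by rewrite normr_sg lern1 leq_b1.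
Qed.

Lemma weak_open_basis (U : set X) (x : X) (a : nat -> R) (A : R) :
  @open (@weak_topology R X) U -> U x -> (forall k, `|a k| <= A) ->
  \forall k \near \oo, U (x + a k *: e k).
Proof.
move=> oU Ux aA; apply: weak_open_eventually oU Ux _ => f.
have A0 : 0 <= A := le_trans (normr_ge0 _) (aA 0%N).
apply/cvgrPdist_lt => eps eps0.
have d0 : 0 < eps / (A + 1) by rewrite divr_gt0// ltr_wpDl.
have /cvgrPdist_lt/(_ _ d0) := dual_basis_cvg0 f.
apply: filterS => k; rewrite sub0r normrN => fk.
rewrite dual_evalD dual_evalZ opprD addrA subrr sub0r normrN normrM.
apply: (@le_lt_trans _ _ (A * `|dual_eval f (e k)|)); first by rewrite ler_wpM2r.
move: fk; rewrite ltr_pdivlMr ?ltr_wpDl// => fk.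
by apply: le_lt_trans fk; rewrite mulrC ler_wpM2l//; lra.
Qed.

(** Otherwise points outside U at harmonic distances from x would converge to x in
norm, hence against every continuous form. *)
Lemma weak_open_norm (U : set X) (x : X) :
  @open (@weak_topology R X) U -> U x ->
  exists2 d, 0 < d & forall y, `|x - y| <= d -> U y.
Proof.
move=> oU Ux; apply: contrapT => nd.
have /choice[y yP] n : exists y, `|x - y| <= n.+1%:R^-1 /\ ~ U y.
  apply: contrapT => ny; apply: nd; exists n.+1%:R^-1; first by rewrite invr_gt0.
  by move=> y xy; apply: contrapT => nU; apply: ny; exists y.
suff [N _ /(_ N (leqnn N))] : \forall n \near \oo, U (y n) by exact: (yP N).2.
apply: weak_open_eventually oU Ux _ => f.
have [C C0 fC] := dual_bounded f.
apply/cvgrPdist_le => eps eps0.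
have d0 : 0 < eps / C by rewrite divr_gt0.
have /cvgrPdist_le/(_ _ d0) := @cvg_harmonic R.
apply: filterS => n /=; rewrite sub0r normrN ger0_norm ?invr_ge0// => nC.
have -> : dual_eval f x - dual_eval f (y n) = dual_eval f (x - y n).
  by rewrite -[- y n]scaleN1r dual_evalD dual_evalZ mulN1r.
apply: (le_trans (fC _)); rewrite mulrC -ler_pdivlMr//.
exact: le_trans (yP n).1 nC.
Qed.

End weak.

Section diameter.
Context {R : realType} {X : normedModType R} (F : c0_frame X).
Local Notation e := (vec F).
Local Notation u := (unit_vec F).
Local Notation h := (coord F).
Local Notation K := (coord_bound F).
Local Notation M := (vec_bound F).
Local Notation N := (newnorm F).

Lemma newnorm_basis_ge k : 2 <= N (2 *: e k).
Proof.
apply: (@gauge_ge R X (hull F) (4 * K) (hull_ex F)) => s /(coord_hull_le _ k).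
by rewrite linearZ/= coord_vec eqxx mulr1 normr_nat.
Qed.

(** The missing mass t - s is put on the core. *)
Lemma hull_mono s t x : s <= t -> hull F s x -> hull F t x.
Proof.
move=> st hx; rewrite -[t](subrK s) -[x]add0r; apply: hullD hx.
apply: core_hull; exists 0; first exact: finite_vec0.
split=> [|k]; last by rewrite linear0 normr0 subr_ge0.
by rewrite subrr normr0 mulr_ge0 ?subr_ge0// ltW// slack_gt0.
Qed.

(** The simultaneous motion of all three components of a point of the hull: the
coefficients of e_k in the two resulting points differ by
2 lam + 2 mu + 2 nu = 2. *)
Lemma weakly_open_far_points (U : set X) : @open (@weak_topology R X) U ->
  unit_ball N `&` U !=set0 ->
  exists x y, [/\ unit_ball N x, unit_ball N y, U x, U y & 2 <= N (x - y)].
Proof.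
move=> oU [w [Bw Uw]].
have [[Ntri Nhom N0] _] := newnorm_equivalent F.
have [d d0 dU] := weak_open_norm U w oU Uw.
have w0 : 0 < `|w| + 1 by rewrite ltr_wpDl.
(* shrink w slightly, to get a point of U with norm less than 1 *)
pose t := 1 - Num.min 1 (d / (`|w| + 1)).
have t1 : t < 1 by rewrite /t ltrBlDr ltrDl lt_min ltr01 divr_gt0.
have t0 : 0 <= t by rewrite /t subr_ge0 ge_min lexx.
have Utw : U (t *: w).
  apply: dU; rewrite -{1}[w]scale1r -scalerBl normrZ /t opprB addrC subrK.
  rewrite ger0_norm; last by rewrite le_min ler01 divr_ge0 ?ltW.
  apply: (@le_trans _ _ (d / (`|w| + 1) * `|w|)).
    by rewrite ler_wpM2r// ge_min lexx orbT.
  by rewrite mulrAC ler_pdivrMr// ler_wpM2l ?ltW//; lra.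
have [s s1 hs] : exists2 s, s < 1 & hull F s (t *: w).
  apply: (@gauge_lt R X (hull F) (4 * K) (hull_ex F)).
  rewrite -/(N _) Nhom ger0_norm//; apply: le_lt_trans t1.
  by rewrite ler_piMr.
(* the weights must add up to 1 exactly for the difference to be 2 e_k *)
have := hull_mono _ _ _ (ltW s1) hs.
move=> [lam [mu [nu [p [q [c [cp cq cc sum1 twE]]]]]]].
have [d' d'0 dU'] := weak_open_norm U _ oU Utw.
have d4 : 0 < d' / 4 by rewrite divr_gt0.
have [p' [q' [pp' qq' att]]] := cone_attach F _ _ _ _ _ d4 cp cq.
pose z := 2 *: (p' - q') - (lam - mu) *: u + c.
have Uz : U z.
  apply: dU'; rewrite twE /z.
  rewrite opprD addrACA. rewrite subrr addr0. rewrite opprD addrACA subrr addr0.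
  rewrite -scalerBr normrZ normr_nat [- (p' - q')]opprD addrACA -opprD.
  by have := ler_normB (p - p') (q - q'); lra.
pose a k := 2 * lam + (nu - h k c); pose b k := - (2 * mu) + (- nu - h k c).
have lam0 := cone_ge0 F _ _ cp; have mu0 := cone_ge0 F _ _ cq.
have nu0 := core_ge0 F _ _ cc.
have hc k : `|h k c| <= nu by case: cc => y _ [].
have Ua : \forall k \near \oo, U (z + a k *: e k).
  apply: (weak_open_basis F U z a (2 * lam + 2 * nu)) => // k.
  by have := hc k; rewrite !ler_norml /a => /andP[? ?]; apply/andP; split; lra.
have Ub : \forall k \near \oo, U (z + b k *: e k).
  apply: (weak_open_basis F U z b (2 * mu + 2 * nu)) => // k.
  by have := hc k; rewrite !ler_norml /b => /andP[? ?]; apply/andP; split; lra.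
have [n _ nU] := filterI Ua Ub.
have [k [nk cp' cq' cpk cqk]] := att n.
have [Uak Ubk] := nU k nk.
exists (z + a k *: e k), (z + b k *: e k); split=> //.
- apply: newnorm_le; exists lam, mu, nu, (p' + lam *: e k), q',
    (c + (nu - h k c) *: e k); split=> //.
    by have := core_flip F nu c k false cc; rewrite expr0 mul1r.
  rewrite /z /a [p' + _ - q']addrAC [2 *: (p' - q' + _)]scalerDr scalerA.
  by rewrite [(2 * lam + _) *: _]scalerDl [X in _ = X + _]addrAC [RHS]addrACA.
- apply: newnorm_le; exists lam, mu, nu, p', (q' + mu *: e k),
    (c + (- nu - h k c) *: e k); split=> //.
    by have := core_flip F nu c k true cc; rewrite expr1 mulN1r.
  rewrite /z /b [- (q' + _)]opprD [p' + (- q' - _)]addrA [2 *: (p' - q' + _)]scalerDr.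
  rewrite [2 *: (- (mu *: _))]scalerN scalerA -scaleNr.
  by rewrite [(- (2 * mu) + _) *: _]scalerDl [X in _ = X + _]addrAC [RHS]addrACA.
- have -> : z + a k *: e k - (z + b k *: e k) = 2 *: e k.
    rewrite opprD addrACA subrr add0r -scalerBl; congr (_ *: _).
    by rewrite /a /b; lra.
  exact: newnorm_basis_ge.
Qed.

Lemma diam_weakly_open (W : set X) : W !=set0 ->
  relatively_weakly_open (unit_ball N) W -> diam N W = 2%:E.
Proof.
move=> W0 [U oU WE]; have [[Ntri Nhom N0] _] := newnorm_equivalent F.
apply/eqP; rewrite eq_le; apply/andP; split.
  apply: ge_ereal_sup => _ [[x y] [/= Wx Wy] <-]; rewrite lee_fin.
  have Bx : N x <= 1 by move: Wx; rewrite WE => -[].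
  have By : N y <= 1 by move: Wy; rewrite WE => -[].
  apply: (le_trans (Ntri _ _)); rewrite -scaleN1r Nhom normrN1 mul1r.
  by rewrite (le_trans (lerD Bx By)).
have [x [y [Bx By Ux Uy xy]]] : exists x y,
    [/\ unit_ball N x, unit_ball N y, U x, U y & 2 <= N (x - y)].
  by apply: weakly_open_far_points => //; rewrite -WE.
apply: (@le_trans _ _ (N (x - y))%:E); first by rewrite lee_fin.
by apply: ereal_sup_ubound; exists (x, y) => //; rewrite WE; split.
Qed.

End diameter.

(** * Small convex combinations of slices *)

Section slices.
Context {R : realType} {X : normedModType R} (F : c0_frame X).
Local Notation e := (vec F).
Local Notation u := (unit_vec F).
Local Notation h := (coord F).
Local Notation l := (lim_form F).
Local Notation K := (coord_bound F).
Local Notation M := (vec_bound F).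
Local Notation N := (newnorm F).
Local Notation B := (unit_ball N).
Local Notation base := (base F).

Lemma slice_form_dual (j : nat) :
  exists f : @topological_dual R X, forall x, dual_eval f x = h j x - l x.
Proof.
pose f0 x : R^o := h j x - l x.
have flin : linear_for *:%R f0.
  by move=> t x y; rewrite /f0 !linearP /GRing.scale/=; ring.
pose H := GRing.isLinear.Build R X R^o *:%R f0 flin.
pose f : {linear X -> R^o} := HB.pack f0 H.
suff fc : continuous f by exists (exist _ f fc).
apply: bounded_linear_continuous; apply/linear_boundedP.
exists (2 * K); split; first exact: num_real.
move=> r Kr x; apply: (@le_trans _ _ (2 * K * `|x|)); last by rewrite ler_wpM2r// ltW.
rewrite (le_trans (ler_normB _ _))//.
by have := coord_le F j x; have := lim_le F x; lra.
Qed.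

Lemma slice_form_hull j s x : hull F s x -> h j x - l x <= 2 * s.
Proof.
move=> [lam [mu [nu [p [q [c [cp cq cc <- ->]]]]]]].
rewrite !linear_hull coord_unit lim_unit.
rewrite (finite_vec_lim F _ (finite_vec_cone F _ _ cp)).
rewrite (finite_vec_lim F _ (finite_vec_cone F _ _ cq)).
have := coord_cone_le F j _ _ cp; have := coord_cone_ge0 F j _ _ cq.
have := core_lim_le F _ _ cc; have mu0 := cone_ge0 F _ _ cq.
have nu0 := core_ge0 F _ _ cc.
case: cc => y _ [_ /(_ j)]; rewrite !ler_norml => /andP[? ?] /andP[? ?]; lra.
Qed.

Lemma slice_form_le j x : B x -> h j x - l x <= 2.
Proof.
move=> Bx; apply/ler_addgt0Pr => eps eps0.
have e2 : 0 < eps / 2 by lra.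
have [s s1 hs] := newnorm_eps F x 1 _ Bx e2.
by have := slice_form_hull j _ _ hs; lra.
Qed.

Lemma slice_top j : initial F j -> B (2 *: e j - u) /\
  h j (2 *: e j - u) - l (2 *: e j - u) = 2.
Proof.
move=> ij; split; last first.
  rewrite (linearB (h j)) (linearB l) [h j (_ *: _)]linearZ [l (_ *: _)]linearZ/=.
  by rewrite coord_vec eqxx coord_unit lim_vec lim_unit mulr1n; lra.
apply: newnorm_le; exists 1, 0, 0, (e j), 0, 0; split.
- have := cone_gen F (j, true) 1 ler01.
  by rewrite genE ij add0r scale1r.
- exact: cone0.
- exact: core0.
- by rewrite !addr0.
- by rewrite !subr0 addr0 scale1r.
Qed.

Lemma slice_sup j (f : @topological_dual R X) : initial F j ->
  (forall x, dual_eval f x = h j x - l x) -> sup (dual_eval f @` B) = 2.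
Proof.
move=> ij fE; have [Bt ft] := slice_top j ij.
apply/eqP; rewrite eq_le; apply/andP; split.
  apply: ge_sup; first by exists (dual_eval f (2 *: e j - u)), (2 *: e j - u).
  by move=> _ [x Bx <-]; rewrite fE slice_form_le.
rewrite -{1}ft -fE; apply: ub_le_sup; last by exists (2 *: e j - u).
by exists 2 => _ [x Bx <-]; rewrite fE slice_form_le.
Qed.

(** A pair w = (lam, p) showing that x is, up to O(a), the vector 2p - u with almost
full weight on the coordinate j. *)
Definition slice_witness (j : nat) (a : R) (x : X) (w : R * X) : Prop :=
  [/\ cone F w.1 w.2, w.1 <= 1 + a, 1 - 3 * a <= h j w.2 &
    `|x - (2 *: w.2 - u)| <= 8 * hull_bound F * a].

(** If x has weights lam, mu, nu on 2P - u, u - 2P and the core, the form is at most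
2 lam + 5/4 nu while lam + mu + nu <= 1 + a; being above 2 - a, it leaves
weight O(a) for mu and nu. *)
Lemma slice_approx j a x : 0 < a -> B x -> 2 - a < h j x - l x ->
  exists w, slice_witness j a x w.
Proof.
move=> a0 Bx fx; have [s s1] := newnorm_eps F x 1 _ Bx a0.
move=> [lam [mu [nu [p [q [c [cp cq cc sE xE]]]]]]]; exists (lam, p).
have lp := coord_cone_le F j _ _ cp; have q0 := coord_cone_ge0 F j _ _ cq.
have lam0 := cone_ge0 F _ _ cp; have mu0 := cone_ge0 F _ _ cq.
have nu0 := core_ge0 F _ _ cc.
(* this is where the core loses against 2P - u: the slack makes l small on it *)
have fc : h j c - l c <= 5 / 4 * nu.
  have := core_lim_le F _ _ cc.
  case: (cc) => y _ [_ /(_ j)]; rewrite !ler_norml => /andP[? ?] /andP[? ?]; lra.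
have {}fx : 2 - a < 2 * h j p - 2 * h j q + (h j c - l c).
  move: fx; rewrite {1 2}xE !linear_hull coord_unit lim_unit.
  rewrite (finite_vec_lim F _ (finite_vec_cone F _ _ cp)).
  rewrite (finite_vec_lim F _ (finite_vec_cone F _ _ cq)); lra.
split=> //=; [lra|lra|].
have -> : x - (2 *: p - u) = (1 - lam + mu) *: u - 2 *: q + c.
  rewrite xE [2 *: (p - q)]scalerBr.
  have -> : (1 - lam + mu) *: u = u - (lam - mu) *: u.
    by rewrite -{2}[u]scale1r -scalerBl; congr (_ *: _); ring.
  move: (2 *: p) (2 *: q) ((lam - mu) *: u) => P Q V.
  rewrite opprB addrC -[P - Q - V]addrA -[P + _ + c]addrA [u - P + _]addrA subrK.
  by rewrite addrA [- Q - V]addrC addrA.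
have M0 := vec_bound_gt0 F; have s0 := slack_gt0 F; have u0 := normr_ge0 u.
have nq := norm_cone_le F _ _ cq; have nc := norm_core_le F _ _ cc.
rewrite (le_trans (ler_normD _ _))//.
apply: (@le_trans _ _ (6 * a * `|u| + 2 * (M * (2 * a)) + (slack F + 2 * M) * (4 * a))).
  apply: lerD.
    rewrite (le_trans (ler_normB _ _))// lerD// normrZ ?normr_nat.
      by rewrite ler_wpM2r// ler_norml; apply/andP; split; lra.
    rewrite ler_wpM2l// (le_trans nq)// ler_pM2l//; lra.
  by rewrite (le_trans nc)// ler_wpM2l//; lra.
have U := mulr_ge0 (ltW a0) u0; have V := mulr_gt0 a0 M0; have W := mulr_gt0 a0 s0.
rewrite /hull_bound; lra.
Qed.

(** Each h_k(p_i) is at most 4a plus twice the weight of j_i on the parents of k,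
plus 2 if k = j_i.  The j_i are distinct and initial, so the weights on
either parent add up to at most 1. *)
Lemma sum_coord_le (n : nat) (j : 'I_n -> nat) (p : 'I_n -> X)
    (lam : 'I_n -> R) a k : injective j -> (forall i, initial F (j i)) ->
  0 <= a -> a <= 1 ->
  (forall i, cone F (lam i) (p i)) -> (forall i, lam i <= 1 + a) ->
  (forall i, 1 - 3 * a <= h (j i) (p i)) ->
  \sum_(i < n) h k (p i) <= 4 * a * n%:R + 6.
Proof.
move=> jinj ji a0 a1 cp lama hp.
have term i : h k (p i) <= 4 * a + 2 * (j i == k)%:R +
    2 * (h (j i) (base k true) + h (j i) (base k false)).
  have k0 := coord_cone_ge0 F k _ _ (cp i).
  have kl := coord_cone_le F k _ _ (cp i).
  have g0 := (coord_ge0 F (j i)).2 k true; have g1 := (coord_ge0 F (j i)).2 k false.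
  have := lama i; have := hp i.
  case: eqVneq => [_|jk] H1 H2; first by rewrite /=; lra.
  have := initial_cone_le F _ _ _ _ (ji i) jk (cp i); move: g0 g1.
  set A := h (j i) _; set B := h (j i) (base k false) => g0 g1 H3.
  have : h k (p i) * (A + B) <= 2 * (A + B).
    by rewrite ler_wpM2r ?addr_ge0//; lra.
  by rewrite /= ; lra.
apply: (le_trans (ler_sum _ (fun i _ => term i))).
rewrite !big_split/= -!mulr_sumr big_split/= sumr_const card_ord -mulr_natr.
have count : \sum_(i < n) (j i == k)%:R <= 1 :> R.
  have [[i ik]|nk] := pselect (exists i, j i = k).
    rewrite (bigD1 i)//= ik eqxx big1 ?addr0// => i' ii'.
    by rewrite -ik (inj_eq jinj) (negPf ii').
  by rewrite big1// => i _; case: eqP => // jk; case: nk; exists i.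
have sb b : \sum_(i < n) h (j i) (base k b) <= 1.
  pose J := [seq j i | i <- enum 'I_n].
  have -> : \sum_(i < n) h (j i) (base k b) = \sum_(i <- J) h i (base k b).
    by rewrite big_map big_enum.
  apply: sum_initial_le1; first by rewrite map_inj_uniq// enum_uniq.
  by move=> _ /mapP[i _ ->].
by have := sb true; have := sb false; lra.
Qed.

Lemma newnorm_le_norm x : N x <= 4 * K * `|x|.
Proof. by apply: newnorm_le; exact: hull_ex. Qed.

Lemma initial_seq : exists j : nat -> nat, injective j /\ forall i, initial F (j i).
Proof.
have /choice[f fP] m : exists n, (m <= n)%N /\ initial F n.
  by have [n mn nI] := initial_often F m; exists n.
pose j := fix j (i : nat) := if i is i'.+1 then f (j i').+1 else f 0%N.
exists j; split; last by case=> [|i]; apply: (fP _).2.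
have jlt : {homo j : i i' / (i < i')%N}.
  by apply: homo_ltn => [x y z|i]; [exact: ltn_trans|exact: (fP _).1].
move=> i i' jii'; have [/jlt||//] := ltngtP i i'; first by rewrite jii' ltnn.
by move=> /jlt; rewrite jii' ltnn.
Qed.

(** The coordinates of the sums of the p_i and of the q_i both lie in
[0, 4 a n + 6], so their difference has norm at most M (4 a n + 6); dividing
by n leaves O(a + 1/n). *)
Lemma small_convex_combination (n : nat) (a : R) : 0 < a -> a <= 1 -> (0 < n)%N ->
  exists2 D : set X, is_convex_combination_of_slices B D &
    (diam N D <= (4 * K * (M * (8 * a + 12 / n%:R) + 16 * hull_bound F * a))%:E)%E.
Proof.
move=> a0 a1 n0; have [j [jinj ji]] := initial_seq.
have nR : 0 < n%:R :> R by rewrite ltr0n.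
pose S (i : 'I_n) := [set x | B x /\ 2 - a < h (j i) x - l x].
exists [set \sum_(i < n) n%:R^-1 *: x i | x in [set x : 'I_n -> X | forall i, S i (x i)]].
  exists n, (fun=> n%:R^-1), S; split=> //.
  - move=> i; have [f fE] := slice_form_dual (j i).
    exists f, a; rewrite (slice_sup (j i) f (ji i) fE) a0/=; split; first lra.
    by apply/seteqP; split=> x [Bx fx]; split=> //; move: fx; rewrite fE.
  - by move=> i; rewrite invr_gt0.
  - by rewrite sumr_const card_ord -[_ *+ n]mulr_natr mulVf ?gt_eqF.
apply: ge_ereal_sup => _ [[_ _] [/= [x Sx <-] [y Sy <-]] <-]; rewrite lee_fin.
apply: (le_trans (newnorm_le_norm _)).
rewrite ler_pM2l ?mulr_gt0 ?coord_bound_gt0//.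
have appr (z : 'I_n -> X) : (forall i, S i (z i)) ->
    exists w : 'I_n -> R * X, forall i : 'I_n, slice_witness (j i) a (z i) (w i).
  move=> Sz; have /choice[w Hw] (i : 'I_n) : exists w, slice_witness (j i) a (z i) w.
    by have [Bz fz] := Sz i; exact: slice_approx.
  by exists w.
have [P PP] := appr x Sx; have [Q QQ] := appr y Sy.
pose p i := (P i).2; pose q i := (Q i).2.
pose r i := (x i - (2 *: p i - u)) - (y i - (2 *: q i - u)).
have -> : \sum_(i < n) n%:R^-1 *: x i - \sum_(i < n) n%:R^-1 *: y i =
    n%:R^-1 *: (2 *: (\sum_(i < n) (p i - q i)) + \sum_(i < n) r i).
  rewrite scaler_sumr -big_split/= -sumrB scaler_sumr; apply: eq_bigr => i _.
  rewrite -scalerBr; congr (_ *: _); rewrite /r scalerBr.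
  have -> : 2 *: p i - 2 *: q i = (2 *: p i - u) - (2 *: q i - u).
    by rewrite opprB addrA subrK.
  move: (2 *: p i - u) (2 *: q i - u) => P' Q'.
  by rewrite [- (_ - Q')]opprB addrC addrACA subrK addrAC subrr add0r.
rewrite normrZ ger0_norm ?invr_ge0 ?ler0n// mulrC ler_pdivrMr//.
rewrite (le_trans (ler_normD _ _))// mulrDl lerD//.
  rewrite normrZ normr_nat.
  have -> : M * (8 * a + 12 / n%:R) * n%:R = 2 * (M * (4 * a * n%:R + 6)).
    by field; rewrite gt_eqF.
  rewrite ler_pM2l//; apply: finite_vec_norm_le => [|k].
    apply: big_ind => [||i _]; [exact: finite_vec0|exact: finite_vecD|].
    rewrite -scaleN1r; apply: finite_vecD.
      by have [c _ _ _] := PP i; exact: finite_vec_cone c.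
    by apply: finite_vecZ; have [c _ _ _] := QQ i; exact: finite_vec_cone c.
  rewrite linear_sum; under eq_bigr do rewrite linearB.
  rewrite sumrB ler_norml.
  have T (L : 'I_n -> R * X) (z : 'I_n -> X) :
      (forall i : 'I_n, slice_witness (j i) a (z i) (L i)) ->
    0 <= \sum_(i < n) h k (L i).2 <= 4 * a * n%:R + 6.
    move=> LL; apply/andP; split.
      by apply: sumr_ge0 => i _; have [c _ _ _] := LL i; exact: coord_cone_ge0 c.
    apply: (sum_coord_le n (fun i => j i) _ (fun i => (L i).1) a k) => //.
    - by move=> i i' /jinj/val_inj.
    - exact: ltW.
    - by move=> i; have [] := LL i.
    - by move=> i; have [] := LL i.
    - by move=> i; have [] := LL i.
  have /andP[H1 H2] := T P x PP; have /andP[H3 H4] := T Q y QQ.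
  by apply/andP; split; move: H1 H2 H3 H4; rewrite /p /q; lra.
rewrite (le_trans (ler_norm_sum _ _ _))//.
rewrite mulr_natr -[n in leRHS]card_ord -sumr_const; apply: ler_sum => i _.
rewrite (le_trans (ler_normB _ _))//.
have [_ _ _ H1] := PP i; have [_ _ _ H2] := QQ i.
by move: H1 H2; rewrite -/(p i) -/(q i); lra.
Qed.

End slices.

Theorem theorem2p5 (R : realType) (X : completeNormedModType R)
    (hX : contains_isomorphic_copy (c0 R) X) :
  exists N : X -> R,
    [/\ equivalent_norm N,
        forall W : set X, W !=set0 -> relatively_weakly_open (unit_ball N) W ->
          diam N W = 2%:E &
        forall eta : R, 0 < eta ->
          exists2 D : set X, is_convex_combination_of_slices (unit_ball N) D &
            (diam N D < eta%:E)%E].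
Proof.
have [F] := c0_frame_of_copy hX; exists (newnorm F); split.
- exact: newnorm_equivalent.
- exact: diam_weakly_open.
move=> eta eta0.
set K := coord_bound F; set M := vec_bound F; set H := hull_bound F.
have K0 : 0 < K by exact: coord_bound_gt0.
have M0 : 0 < M by exact: vec_bound_gt0.
have H0 : 0 < H by exact: hull_bound_gt0.
pose A := 4 * K * (M * 8 + 16 * H); pose C := 4 * K * (M * 12).
have A0 : 0 < A by rewrite !mulr_gt0// addr_gt0// mulr_gt0.
have C0 : 0 < C by rewrite !mulr_gt0.
pose a := Num.min 1 (eta / 3 / A).
have a0 : 0 < a by rewrite lt_min ltr01/= !divr_gt0.
have a1 : a <= 1 by rewrite ge_min lexx.
pose n := (Num.trunc (C / (eta / 3))).+1.
have nC : C / n%:R <= eta / 3.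
  rewrite ler_pdivrMr ?ltr0n// mulrC -ler_pdivrMr; last lra.
  by rewrite ltW// truncnS_gt.
have aA : A * a <= eta / 3.
  by rewrite mulrC -ler_pdivlMr// ge_min lexx orbT.
have [D DB dD] := small_convex_combination F n a a0 a1 isT.
exists D => //; apply: (le_lt_trans dD); rewrite lte_fin.
have -> : 4 * K * (M * (8 * a + 12 / n%:R) + 16 * H * a) = A * a + C / n%:R.
  by rewrite /A /C; ring.
lra.
Qed.
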